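(* Let $\mathcal X,\mathcal Y$ be real separable Hilbert spaces, let $B,L\ge 0$, $\sigma>0$, $1\le p<\infty$, and let $\mu$ be a probability measure on $\mathcal X$ satisfying conditions (i), (ii), (iii-L), (iii-U) of the context. Suppose that either (a) the noise is Hilbert-valued Gaussian noise, in which case put $\mathcal F=\mathcal F_{B,L}$; or (b) the noise is Gaussian white noise on $\mathcal Y$, in which case let $t>0$ and put $\mathcal F=\mathcal F^t_{B,L}$. Then for any $q>0$, $$\limsup_{m\to\infty}\ \mathcal M_m(\mathcal F;L^p_\mu)\cdot m^{q}=+\infty ,$$ where $\mathcal M_m(\mathcal F;L^p_\mu)$ is either the fixed-design minimax risk or the random-design minimax risk.
   Context: Conditions on $\mu$: (i) $\mu$ has mean zero and finite second moments, i.e. $\int_{\mathcal X}\|X\|_{\mathcal X}^2\,d\mu(X)<\infty$. (ii) Let $\lambda_1\ge\lambda_2\ge\cdots>0$ and $\{\phi_i\}_i\subset\mathcal X$ be the eigenvalues and orthonormal basis of eigenvectors of the covariance operator of $\mu$. The real-valued random variables $\xi_i=\langle X,\phi_i\rangle_{\mathcal X}/\sqrt{\lambda_i}$, $X\sim\mu$, are independent. (iii-L) Each $\xi_i$ is absolutely continuous with respect to Lebesgue measure, and there exist constants $a,b>0$ such that the densities $\nu_i$ of the $\xi_i$ satisfy $\nu_i(x)\ge b$ for all $|x|\le a$ and all $i=1,2,\dots$. (iii-U) The $\xi_i$ have uniformly bounded $p'$th moments, where $p'=\max\{p,2\}$, i.e. $\sup_i(\mathbb E|\xi_i|^{p'})^{1/p'}<\infty$.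 Observations: $Y_i=F(X_i)+\sigma E_i$, $i=1,\dots,m$, with $E_1,\dots,E_m$ i.i.d. Hilbert-valued Gaussian noise: the $E_i$ are drawn from a mean-zero Gaussian measure on $\mathcal Y$ with covariance operator $\Upsilon:\mathcal Y\to\mathcal Y$, $\mathrm{Tr}(\Upsilon)=1$. Gaussian white noise: each $E_i$ is Gaussian white noise on $\mathcal Y$, i.e. $Y_i$ is observed through $\langle Y_i,y\rangle=\langle F(X_i),y\rangle_{\mathcal Y}+\sigma\langle E_i,y\rangle$, $y\in\mathcal Y$, where $y\mapsto\langle E_i,y\rangle$ is a centered Gaussian linear process with $\mathbb E[\langle E_i,y\rangle\langle E_i,y'\rangle]=\langle y,y'\rangle_{\mathcal Y}$. Norm: $\|F\|_{L^p_\mu(\mathcal X;\mathcal Y)}=(\int_{\mathcal X}\|F(X)\|_{\mathcal Y}^p\,d\mu(X))^{1/p}$. Minimax risks: an estimator $\widehat F$ is a mapping from the data to $L^p_\mu(\mathcal X;\mathcal Y)$. Fixed design: $\mathcal M_m(\mathcal F;L^p_\mu)=\inf_{\mathcal D}\inf_{\widehat F}\sup_{F\in\mathcal F}\mathbb E\|F-\widehat F\|_{L^p_\mu(\mathcal X;\mathcal Y)}$, with infimum over designs $\mathcal D=\{X_1,\dots,X_m\}\subset\mathcal X$ and over estimators, and expectation over the $E_i$. Random design: $\mathcal M_m(\mathcal F;L^p_\mu)=\inf_\nu\inf_{\widehat F}\sup_{F\in\mathcal F}\mathbb E\|F-\widehat F\|_{L^p_\mu(\mathcal X;\mathcal Y)}$,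 with infimum over probability measures $\nu$ on $\mathcal X$ and over estimators, where $X_1,\dots,X_m$ are i.i.d. from $\nu$ and independent of the $E_i$, and expectation over the $X_i$ and $E_i$. Classes: $\mathcal F_{B,L}$ is the set of $F:\mathcal X\to\mathcal Y$ with $\|F(X)\|_{\mathcal Y}\le B$ and $\|F(X)-F(X')\|_{\mathcal Y}\le L\|X-X'\|_{\mathcal X}$ for all $X,X'\in\mathcal X$. Given an arbitrary orthonormal basis $\{\psi_i\}_i$ of $\mathcal Y$ and a nondecreasing sequence of positive weights $(w_i)_{i\in\mathbb N}$, set $\|Y\|_{\mathcal Y^t}^2=\sum_i w_i^{2t}|\langle Y,\psi_i\rangle_{\mathcal Y}|^2$ and $\mathcal Y^t=\{Y\in\mathcal Y:\|Y\|_{\mathcal Y^t}<\infty\}$. $\mathcal F^t_{B,L}$ is the set of $F:\mathcal X\to\mathcal Y$ with $\|F(X)\|_{\mathcal Y^t}\le B$ and $\|F(X)-F(X')\|_{\mathcal Y}\le L\|X-X'\|_{\mathcal X}$ for all $X,X'\in\mathcal X$.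
   Formalization: B and L are assumed positive, and Y nonzero in case (b): for B = 0 or Y = 0 the risk is 0, and for L = 0 the class consists of constants, estimated at rate m^(-1/2) under Hilbert-valued noise, so the claim fails. *)

(* Defs.v *)
From HB Require Import structures.
From mathcomp Require Import all_boot all_order all_algebra.
From mathcomp Require Import all_classical all_reals all_analysis.

Set Implicit Arguments.
Unset Strict Implicit.
Unset Printing Implicit Defensive.

Import Order.TTheory GRing.Theory Num.Theory.
Import numFieldNormedType.Exports.

Local Open Scope classical_set_scope.
Local Open Scope ring_scope.

HB.mixin Record isHilbert (R : realType) X & CompleteNormedModule R X := {
  inner : {dot X for @idfun R} ;
  inner_norm : forall x : X, inner x x = `|x| ^+ 2
}.

#[short(type="hilbertType")]
HB.structure Definition Hilbert (R : realType) :=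
  {X of CompleteNormedModule R X & isHilbert R X}.

Notation "''[' x , y ]" := (inner x y) : ring_scope.

Definition separable (T : topologicalType) : Prop :=
  exists D : set T, countable D /\ dense D.

Notation borel X := (g_sigma_algebraType (@open X)).

Section hilbert.
Context {R : realType} {H : hilbertType R}.

(* J is the set of indices, so that finite-dimensional spaces are covered; for
   an orthonormal family, convergence of the expansions is completeness. *)
Definition orthonormal_basis (J : set nat) (e : nat -> H) : Prop :=
  (forall i j, J i -> J j -> '[e i, e j] = (i == j)%:R) /\
  (forall x : H,
     (fun n : nat => \sum_(i < n | (i : nat) \in J) '[x, e i] *: e i)
       @ \oo --> x).

(* Only used for covariance operators, whose diagonal terms are nonnegative. *)
Definition has_trace (A : H -> H) (c : R) : Prop :=
  forall (J : set nat) (e : nat -> H), orthonormal_basis J e ->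
    \esum_(i in J) ('[A (e i), e i])%:E = c%:E.

Variable mu : probability (borel H) R.

(* Weak form of the Bochner mean; the two agree when the second moment is
   finite. *)
Definition mean_zero : Prop :=
  forall y : H, (\int[mu]_x ('[x, y])%:E = 0)%E.

Definition finite_second_moment : Prop :=
  (\int[mu]_x (`|x : H| ^+ 2)%:E < +oo)%E.

Definition covariance_operator (C : {linear H -> H}) : Prop :=
  forall y z : H, (\int[mu]_x ('[x, y] * '[x, z])%:E = ('[C y, z])%:E)%E.

End hilbert.

Section real_random_variables.
Context {R : realType} {d : measure_display} {T : measurableType d}.
Variable P : probability T R.

Definition mutually_independent (Z : nat -> T -> R) : Prop :=
  forall (s : seq nat) (A : nat -> set R), uniq s ->
    (forall i, measurable (A i)) ->
    P (\bigcap_(i in [set` s]) (Z i @^-1` A i)) =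
      (\prod_(i <- s) P (Z i @^-1` A i))%E.

Definition has_density (Z : T -> R) (f : R -> R) : Prop :=
  [/\ measurable_fun [set: R] f, (forall x, 0 <= f x) &
      forall A : set R, measurable A ->
        P (Z @^-1` A) = (\int[lebesgue_measure]_(x in A) (f x)%:E)%E].

(* [normal_prob 0 0] is not the degenerate Gaussian law in the library. *)
Definition centered_normal (s : R) : set R -> \bar R :=
  if s == 0 then \d_(0 : R) else normal_prob 0 s.

Definition centered_gaussian (Z : T -> R) : Prop :=
  exists2 s : R, 0 <= s &
    forall A : set R, measurable A -> P (Z @^-1` A) = centered_normal s A.

End real_random_variables.

Section conditions.
Context {R : realType} {X : hilbertType R}.
Variable mu : probability (borel X) R.

Definition covariance_eigenbasis (lambda : nat -> R) (phi : nat -> X) : Prop :=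
  [/\ orthonormal_basis [set: nat] phi,
      (forall i, 0 < lambda i),
      (forall i j, (i <= j)%N -> lambda j <= lambda i) &
      exists2 C : {linear X -> X}, covariance_operator mu C &
        forall i, C (phi i) = lambda i *: phi i].

Definition xi (lambda : nat -> R) (phi : nat -> X) (i : nat) : borel X -> R :=
  fun x => '[x, phi i] / Num.sqrt (lambda i).

(* A density is only defined up to null sets; the bound is asked of a version. *)
Definition densities_bounded_below (Z : nat -> borel X -> R) : Prop :=
  exists a b : R, [/\ 0 < a, 0 < b & forall i,
    exists2 nu : R -> R, has_density mu (Z i) nu &
      forall x, `|x| <= a -> b <= nu x].

Definition bounded_moments (p : R) (Z : nat -> borel X -> R) : Prop :=
  (ereal_sup [set 'N[mu]_(p%:E)[EFin \o Z i] | i in [set: nat]] < +oo)%E.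

End conditions.

Section iid.
Context {R : realType} {d : measure_display} {T : measurableType d}.

Definition tuple_cons n (u : T * n.-tuple T) : n.+1.-tuple T :=
  [tuple of u.1 :: u.2].

Lemma measurable_tuple_cons n : measurable_fun setT (@tuple_cons n).
Proof. exact: (measurable_cons measurable_fst measurable_snd). Qed.

HB.instance Definition _ n :=
  isMeasurableFun.Build _ _ _ _ (@tuple_cons n) (@measurable_tuple_cons n).

Fixpoint iid_law (P : probability T R) (n : nat) : probability (n.-tuple T) R :=
  match n with
  | 0 => \d_([tuple] : 0.-tuple T)
  | n'.+1 => distribution (P \x iid_law P n')%E (@tuple_cons n')
  end.

End iid.

Section operators.
Context {R : realType} {X Y : hilbertType R}.

Section Lp.
Variables (mu : probability (borel X) R) (p : R).

Definition Lp_norm (F : X -> Y) : \bar R :=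
  Lnorm mu p%:E (fun x : borel X => (`|F x|)%:E).

Definition Lp_space : set (X -> Y) :=
  [set F | measurable_fun setT (F : borel X -> borel Y) /\
           (Lp_norm F < +oo)%E].

Definition Lp_dist (F G : X -> Y) : \bar R := Lp_norm (fun x => F x - G x).

Definition Lp_open (U : set (X -> Y)) : Prop :=
  forall F, Lp_space F -> U F ->
    exists2 r : R, 0 < r &
      forall G, Lp_space G -> (Lp_dist F G < r%:E)%E -> U G.

(* Measurable maps from the data to L^p with its Borel sigma-algebra, given by
   representatives. Without measurability the expected loss is not defined
   (on non-measurable integrands the library integral is a lower integral). *)
Definition estimator d (T : measurableType d) : set (T -> X -> Y) :=
  [set Fhat | (forall z, Lp_space (Fhat z)) /\
              forall U, Lp_open U -> measurable (Fhat @^-1` U)].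

End Lp.

(* The risks are defined for a general observation model: a noise sample e in O
   turns the exact value y into the observation [obs y e]; gamma is the law of
   the noise. *)
Section minimax.
Variables (mu : probability (borel X) R) (p : R).
Context {d : measure_display} {O : measurableType d}.
Variables (gamma : probability O R) (obs : Y -> O -> O).
Variable cF : set (X -> Y).

Definition fixed_data m (D : m.-tuple X) (F : X -> Y) (e : m.-tuple O) :
    m.-tuple O :=
  [tuple obs (F (tnth D i)) (tnth e i) | i < m].

Definition fixed_design_risk (m : nat) : \bar R :=
  ereal_inf [set
    ereal_inf [set
      ereal_sup [set
        (\int[iid_law gamma m]_e Lp_dist mu p F (Fhat (fixed_data D F e)))%E
      | F in cF]
    | Fhat in @estimator mu p _ (m.-tuple O)]
  | D in [set: m.-tuple X]].

Definition random_data m (F : X -> Y) (z : m.-tuple (borel X * O)) :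
    m.-tuple (borel X * O) :=
  [tuple ((tnth z i).1, obs (F (tnth z i).1) (tnth z i).2) | i < m].

Definition random_design_risk (m : nat) : \bar R :=
  ereal_inf [set
    ereal_inf [set
      ereal_sup [set
        (\int[iid_law (nu \x gamma)%E m]_z
           Lp_dist mu p F (Fhat (random_data F z)))%E
      | F in cF]
    | Fhat in @estimator mu p _ (m.-tuple (borel X * O))]
  | nu in [set: probability (borel X) R]].

End minimax.

Definition lipschitz_class (B L : R) : set (X -> Y) :=
  [set F | (forall x, `|F x| <= B) /\
           (forall x x', `|F x - F x'| <= L * `|x - x'|)].

Definition weighted_norm (J : set nat) (psi : nat -> Y) (w : nat -> R) (t : R)
    (y : Y) : \bar R :=
  ((\esum_(i in J) (w i `^ (2 * t) * `|'[y, psi i]| ^+ 2)%:E) `^ 2^-1)%E.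

Definition weighted_lipschitz_class (J : set nat) (psi : nat -> Y)
    (w : nat -> R) (t B L : R) : set (X -> Y) :=
  [set F | (forall x, (weighted_norm J psi w t (F x) <= B%:E)%E) /\
           (forall x x', `|F x - F x'| <= L * `|x - x'|)].

End operators.

Section noise.
Context {R : realType} {Y : hilbertType R}.

(* By the Riesz theorem the continuous linear functionals are the '[., y]. *)
Definition hilbert_gaussian (gamma : probability (borel Y) R)
    (Ups : {linear Y -> Y}) : Prop :=
  [/\ (forall y : Y, centered_gaussian gamma (fun e : borel Y => '[e, y])),
      covariance_operator gamma Ups &
      has_trace Ups 1].

Definition hilbert_obs (sigma : R) (y : Y) (e : borel Y) : borel Y :=
  y + sigma *: (e : Y).

Definition cylinders : set (set (Y -> R)) :=
  [set E | exists (y : Y) (A : set R), measurable A /\ E = [set e | A (e y)]].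

Notation process := (g_sigma_algebraType cylinders).

Definition white_noise (gamma : probability process R) : Prop :=
  [/\ (forall y : Y, centered_gaussian gamma (fun e : process => e y)),
      (forall (a : R) (y y' : Y),
         {ae gamma, forall e : process, e (a *: y + y') = a * e y + e y'}) &
      forall y y' : Y,
        (\int[gamma]_e (e y * e y')%:E = ('[y, y'])%:E)%E].

Definition white_obs (sigma : R) (y : Y) (e : process) : process :=
  fun z => '[y, z] + sigma * e z.

End noise.

Notation process Y := (g_sigma_algebraType (@cylinders _ Y)).

(* Main.v *)
Require Import Defs.
From HB Require Import structures.
From mathcomp Require Import all_boot all_order all_algebra.
From mathcomp Require Import all_classical all_reals all_analysis measurable_realfun.
From mathcomp Require Import ring lra zify.

Set Implicit Arguments.
Unset Strict Implicit.
Unset Printing Implicit Defensive.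

Import Order.TTheory GRing.Theory Num.Theory.
Import numFieldNormedType.Exports.

Local Open Scope classical_set_scope.
Local Open Scope ring_scope.

(** Exact data are at least as informative as noisy data, and already
    incur a risk that is not polynomially small.  For every realization of the
    noise (and of the design points, if they are random) the estimate is a
    function of the exact values of the target at the [m] design points, so it
    suffices to bound the error of recovering a function from [m] exact values,
    on average over a suitable finite family of targets.

    Fix [k].  The first [k+1] normalized coordinates [xi 0, ..., xi k] are
    independent with densities at least [b] on [[-a, a]].  A grid of
    [N = (2 * n) ^ (k+1)] cells in these coordinates carries [N] bumps with
    disjoint supports and height of order [1 / n]; each of them is of order
    [1 / n] on a box of probability of order [1 / N].  The targets are all the
    signed sums of these bumps, times a fixed unit vector of [Y], scaled by a
    constant independent of [n] so that they lie in the class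
    ([lipschitz_class_line], [weighted_lipschitz_class_line]).  A design of
    [m = n ^ (k+1) <= N / 2] points misses at least half of the supports
    ([card_unhit]).  Flipping the signs of the missed bumps does not change the
    data, but moves the target by an [L^p] distance of order [1 / n]
    ([signed_field_flip_dist]); by the triangle inequality the estimator errs by
    half of it for one of the two sign patterns, hence on average over all
    patterns ([max_risk_ge_pairing], [signed_field_risk_ge]).

    So the risk for [m = n ^ (k+1)] is at least [C / n], with [C > 0]
    depending on [k] but not on [n] ([minimax_risk_rate]).  As the design space is
    infinite dimensional, [k] may be chosen with [(k+1) * q > 1], and the risk
    times [m ^ q] is then unbounded.

    What remains is measurability: exchanging the average over the targets with
    the expectation requires the loss to be a measurable function of the
    outcome.  This is where the definition of estimators through [Lp_open] sets
    ([measurable_estimator_dist]) and the separability of [Y]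
    ([measurable_comp2_separable]) enter. *)

(** * Inner products *)

Section inner_product.
Context {R : realType} {H : hilbertType R}.
Implicit Types x y e : H.

Lemma inner_subl x y z : '[x - y, z] = '[x, z] - '[y, z].
Proof. exact: linearBl. Qed.

Lemma inner_scalel a x y : '[a *: x, y] = a * '[x, y].
Proof. exact: linearZl_LR. Qed.

Lemma inner_sym x y : '[x, y] = '[y, x].
Proof. by rewrite hermC /= expr0 mul1r. Qed.

Lemma abs_inner_unit x e : '[e, e] = 1 -> `|'[x, e]| <= `|x|.
Proof.
move=> e1; set c := '[x, e].
have : 0 <= `|x - c *: e| ^+ 2 by rewrite exprn_ge0.
rewrite -inner_norm inner_subl inner_scalel.
rewrite [X in X - _]inner_sym inner_subl inner_scalel.
rewrite [X in _ - _ * X]inner_sym inner_subl inner_scalel e1.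
rewrite [X in X - _ - _]inner_norm [X in _ - _ * X - _]inner_sym -/c mulr1 subrr mulr0 subr0.
rewrite subr_ge0 -expr2 => h.
by rewrite -(@ler_pXn2r _ 2) ?nnegrE// real_normK ?num_real.
Qed.

Lemma unit_norm e : '[e, e] = 1 -> `|e| = 1.
Proof.
rewrite inner_norm => /eqP; rewrite -[X in _ == X](expr1n _ 2).
by rewrite eqrXn2// => /eqP.
Qed.

End inner_product.

(** * Borel measurability *)

Section borel.
Context {R : realType}.

Lemma measurable_to_borel d (T : measurableType d) (Y : ptopologicalType) (f : T -> borel Y) :
  (forall U : set Y, open U -> measurable (f @^-1` U)) -> measurable_fun setT f.
Proof.
move=> fo; refine (@measurability _ _ T (borel Y) setT f (@open Y) _ _); [by []|].
by move=> _ [U oU <-]; rewrite setTI; exact: fo.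
Qed.

Lemma continuous_measurable_borel (X Y : ptopologicalType) (f : X -> Y) :
  continuous f -> measurable_fun setT (f : borel X -> borel Y).
Proof.
move=> /continuousP cf; apply: measurable_to_borel => U oU.
by apply: sub_sigma_algebra; exact: cf.
Qed.

Lemma continuous_measurable_real (X : ptopologicalType) (f : X -> R) :
  continuous f -> measurable_fun setT (f : borel X -> R).
Proof.
move=> /continuousP cf.
apply: (measurability _ (RGenOInfty.measurableE R)).
move=> _ [_ [x ->] <-]; rewrite setTI; apply: sub_sigma_algebra.
by apply: cf; exact: interval_open.
Qed.

Lemma countable_bigcup_measurable d (T : measurableType d) U (D : set U)
    (F : U -> set T) : countable D ->
  (forall i, D i -> measurable (F i)) -> measurable (\bigcup_(i in D) F i).
Proof.
rewrite -(eq_countable (card_setT _)) => cD mF; rewrite bigcup_set_type.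
by apply: countable_bigcupT_measurable => // i; apply: mF; exact: set_valP.
Qed.

(** The Borel sigma-algebra of [Y1 * Y2] may be larger than the product of the
    two Borel sigma-algebras, so continuity of [op] does not suffice by itself.
    When [Y1] is separable, the preimage of an open set is a countable union of
    rectangles: balls around a countable dense set, with the points of [Y2] that
    stay in the open set uniformly over the ball. *)
Lemma measurable_comp2_separable d (T : measurableType d) (Y1 Y2 Y3 : normedModType R)
    (op : Y1 * Y2 -> Y3) (f : T -> borel Y1) (g : T -> borel Y2) :
  separable Y1 -> continuous op ->
  measurable_fun setT f -> measurable_fun setT g ->
  measurable_fun setT (fun t => op (f t, g t) : borel Y3).
Proof.
move=> [D [cD dD]] cop mf mg; apply: measurable_to_borel => U oU.
pose r n : R := n.+1%:R^-1.
pose V n (z : Y1) : set Y2 := interior [set y | forall x, ball z (r n) x -> U (op (x, y))].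
have -> : (fun t => op (f t, g t)) @^-1` U =
  \bigcup_n \bigcup_(z in D) ((f @^-1` ball z (r n)) `&` (g @^-1` V n z)).
  apply/seteqP; split=> t /=.
    move=> Ut.
    have := cop (f t, g t) U (open_nbhs_nbhs (conj oU Ut)).
    move=> [[A1 A2] /= [/nbhs_ballP[e1 /= e10 h1] n2] hU].
    have e120 : 0 < e1 / 2 by rewrite divr_gt0.
    have [n hn] : exists n, r n < e1 / 2.
      by have [n] := ltr_add_invr e120; rewrite add0r => hn; exists n.
    have rn0 : 0 < r n by rewrite invr_gt0.
    have [z [z1 z2]] : (ball (f t : Y1) (r n) `&` D) !=set0.
      apply: dD; last exact: ball_open.
      by exists (f t); exact: ballxx.
    exists n => //; exists z => //; split; first exact: ball_sym.
    rewrite /V /=; apply: (@filterS _ _ _ A2) => //.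
    move=> y Ay x zx; apply: (hU (x, y)); split => //=.
    apply: h1; apply: (le_ball _ (ball_triangle z1 zx)).
    by rewrite (splitr e1) ltW// ltrD.
  by move=> [n _ [e De [bd]]] /interior_subset /=; apply.
apply: bigcupT_measurable => n; apply: countable_bigcup_measurable => // e De.
apply: measurableI; rewrite -[X in measurable X]setTI.
  by apply: mf => //; apply: sub_sigma_algebra; exact: ball_open.
by apply: mg => //; apply: sub_sigma_algebra; exact: open_interior.
Qed.

End borel.

(** * The L^p distance and estimators *)

Lemma Lnorm_le d (T : measurableType d) (R : realType) (mu : {measure set T -> \bar R})
    (p : R) (f g : T -> R) : 0 < p ->
  measurable_fun setT f -> measurable_fun setT g ->
  (forall x, 0 <= f x <= g x) ->
  (Lnorm mu p%:E (EFin \o f) <= Lnorm mu p%:E (EFin \o g))%E.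
Proof.
move=> p0 mf mg fg; rewrite unlock.
have mN (h : T -> R) : measurable_fun setT h ->
    measurable_fun setT (fun x => `|(EFin \o h) x| `^ p)%E.
  move=> mh; apply: (measurableT_comp (measurable_poweR p)).
  by apply: measurableT_comp => //; exact/measurable_EFinP.
apply: gt0_ler_poweR; first by rewrite invr_ge0 ltW.
- by rewrite in_itv /= leey andbT integral_ge0// => x _; exact: poweR_ge0.
- by rewrite in_itv /= leey andbT integral_ge0// => x _; exact: poweR_ge0.
apply: ge0_le_integral => //.
- by move=> x _; exact: poweR_ge0.
- exact: mN.
- exact: mN.
- move=> x _; have /andP[f0 fgx] := fg x.
  rewrite /= !lee_fin ge0_ler_powR ?nnegrE//; [exact: ltW|].
  by rewrite !ger0_norm// (le_trans f0).
Qed.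

Section Lp.
Context {R : realType} {X Y : hilbertType R}.
Variables (sepY : separable Y) (mu : probability (borel X) R) (p : R).
Hypothesis p_ge1 : 1 <= p.
Implicit Types F G H : borel X -> borel Y.

Lemma measurable_norm_sub F G : measurable_fun setT F -> measurable_fun setT G ->
  measurable_fun setT (fun x => `|(F x : Y) - G x|).
Proof.
move=> mF mG.
have cs : continuous (fun u : Y * Y => u.1 - u.2).
  by move=> u; apply: cvgB; [exact: cvg_fst|exact: cvg_snd].
exact: (measurableT_comp (continuous_measurable_real (@norm_continuous _ _))
  (measurable_comp2_separable sepY cs mF mG)).
Qed.

Lemma Lp_distC F G : Lp_dist mu p F G = Lp_dist mu p G F.
Proof. by apply: eq_Lnorm => x; rewrite distrC. Qed.

Lemma Lp_dist_triangle F G H : measurable_fun setT F ->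
  measurable_fun setT G -> measurable_fun setT H ->
  (Lp_dist mu p F H <= Lp_dist mu p F G + Lp_dist mu p G H)%E.
Proof.
move=> mF mG mH.
have mFG := measurable_norm_sub mF mG.
have mGH := measurable_norm_sub mG mH.
apply: le_trans (minkowski_EFin mu mFG mGH p_ge1).
apply: Lnorm_le => [|||x].
- exact: lt_le_trans p_ge1.
- exact: measurable_norm_sub.
- exact: measurable_funD.
- by rewrite normr_ge0 /= ler_distD.
Qed.

(** This is the link between the measurability required of an estimator, which
    is phrased with [Lp_open] sets, and the measurability of its loss. *)
Lemma Lp_open_ball F r : measurable_fun setT F ->
  Lp_open mu p [set G | (Lp_dist mu p F G < r%:E)%E].
Proof.
move=> mF G [mG _] /= FGr.
have : (0 <= Lp_dist mu p F G)%E by exact: Lnorm_ge0.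
case E : (Lp_dist mu p F G) FGr => [c| |] // cr _.
exists (r - c); first by rewrite subr_gt0.
move=> H [mH _] GH; apply: le_lt_trans (Lp_dist_triangle mF mG mH) _.
by rewrite E -[r](subrKC c) EFinD lteD2lE.
Qed.

(** Every sublevel set of the loss is the preimage of an [L^p] ball. *)
Lemma measurable_estimator_dist d (T : measurableType d) d' (T' : measurableType d')
    (Fhat : T -> X -> Y) (data : T' -> T) F :
  estimator mu p Fhat -> measurable_fun setT data -> measurable_fun setT F ->
  measurable_fun setT (fun z => Lp_dist mu p F (Fhat (data z))).
Proof.
move=> [_ mFhat] mdata mF.
apply: (measurability _ (ErealGenInftyO.measurableE R)).
move=> _ [_ [r ->] <-]; rewrite setTI.
have -> : (fun z => Lp_dist mu p F (Fhat (data z))) @^-1` `]-oo, r%:E[ =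
    data @^-1` (Fhat @^-1` [set G | (Lp_dist mu p F G < r%:E)%E]).
  by apply/seteqP; split => z /=; rewrite in_itv.
rewrite -[X in measurable X]setTI; apply: mdata => //.
by apply: mFhat; exact: Lp_open_ball.
Qed.

End Lp.

(** * From pairs of parameters to a lower bound on the worst risk *)

Section average.
Context {R : realType} d (T : measurableType d) (P : probability T R).

(** The largest risk is at least the average risk, and the average over [Th] can
    be taken before integrating.  For a fixed outcome [z] the involution [s z]
    permutes the parameters, so the sum of the losses is half the sum of the
    paired losses [loss th z + loss (s z th) z].  The pairing may depend on the
    outcome: this is what makes random designs no harder than fixed ones. *)
Lemma max_risk_ge_pairing (Th : finType) (loss : Th -> T -> \bar R)
    (s : T -> Th -> Th) (c : R) (th0 : Th) :
  0 <= c -> (forall th, measurable_fun setT (loss th)) ->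
  (forall th z, 0 <= loss th z)%E ->
  (forall z, involutive (s z)) ->
  (forall th z, (c%:E <= loss th z + loss (s z th) z)%E) ->
  exists th, ((c / 2)%:E <= \int[P]_z loss th z)%E.
Proof.
move=> c0 mloss loss0 sK hs.
have pointwise z : ((#|Th|%:R * (c / 2))%:E <= \sum_th loss th z)%E.
  have h : (\sum_(th : Th) c%:E <= \sum_th loss th z + \sum_th loss th z)%E.
    rewrite [X in (_ + X)%E](reindex_inj (inv_inj (sK z))) -big_split.
    by apply: lee_sum => th _; exact: hs.
  move: h; case E : (\sum_th loss th z)%E => [a| |] //.
  - rewrite sumEFin -EFinD !lee_fin sumr_const => h.
    rewrite -mulr_natl in h; lra.
  - by move=> _; rewrite leey.
  - have : (0 <= \sum_th loss th z)%E.
      by apply: sume_ge0 => th _; exact: loss0.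
    by rewrite E.
apply: contrapT => /forallNP hlt.
have int_ge0 th : (0 <= \int[P]_z loss th z)%E by exact: integral_ge0.
have int_lt th : fine (\int[P]_z loss th z)%E < c / 2 /\
    (\int[P]_z loss th z)%E = (fine (\int[P]_z loss th z))%:E.
  have := hlt th; have := int_ge0 th.
  case: (\int[P]_z loss th z)%E => [a| |] // _; last by rewrite leey.
  by rewrite lee_fin => /negP; rewrite -ltNge.
have : (\int[P]_z (#|Th|%:R * (c / 2))%:E <= \sum_th \int[P]_z loss th z)%E.
  rewrite -ge0_integral_sum//; apply: ge0_le_integral => //.
  - by move=> z _; rewrite lee_fin mulr_ge0// divr_ge0.
  - exact: emeasurable_sum.
rewrite integral_cst// [X in (_ * X)%E](_ : _ = 1%E) ?mule1; last first.
  exact: probability_setT.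
under eq_bigr do rewrite (int_lt _).2.
rewrite sumEFin lee_fin leNgt => /negP; apply.
rewrite mulr_natl -sumr_const; apply: ltr_sum => [|th _]; last exact: (int_lt th).1.
by apply/hasP; exists th0 => //; rewrite mem_index_enum.
Qed.

End average.

(** * Signed sums of bumps with disjoint supports *)

Section signed_bumps.
Context {R : realType} {X : hilbertType R} {I : finType}.
Variable g : I -> X -> R.
Hypothesis g_disj : forall i j x, g i x != 0 -> g j x != 0 -> i = j.
Implicit Types (th : {ffun I -> bool}) (U : {set I}).

Definition signed_sum th (x : X) : R := \sum_i (-1) ^+ th i * g i x.

Definition flip U th : {ffun I -> bool} := [ffun i => th i (+) (i \in U)].

Lemma flipK U : involutive (flip U).
Proof. by move=> th; apply/ffunP => i; rewrite !ffunE -addbA addbb addbF. Qed.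

Lemma signed_sum_single th x i : g i x != 0 ->
  signed_sum th x = (-1) ^+ th i * g i x.
Proof.
move=> gi; rewrite /signed_sum (bigD1 i)//= big1 ?addr0// => j ji.
have [->|gj] := eqVneq (g j x) 0; first by rewrite mulr0.
by rewrite (g_disj gj gi) eqxx in ji.
Qed.

Lemma signed_sum_eq0 th x : (forall i, g i x = 0) -> signed_sum th x = 0.
Proof. by move=> g0; rewrite /signed_sum big1// => i _; rewrite g0 mulr0. Qed.

Lemma bump_cases x : (exists i, g i x != 0) \/ (forall i, g i x = 0).
Proof.
have [/existsP|/existsPn h] := boolP [exists i, g i x != 0]; first by left.
by right => i; have := h i; rewrite negbK => /eqP.
Qed.

Lemma signed_sum_bounded th (b : R) : 0 <= b ->
  (forall i x, `|g i x| <= b) -> forall x, `|signed_sum th x| <= b.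
Proof.
move=> b0 gb x; have [[i gi]|g0] := bump_cases x.
  by rewrite (signed_sum_single th gi) normrM normrX normrN1 expr1n mul1r.
by rewrite signed_sum_eq0// normr0.
Qed.

(** The factor 2 comes from pairs of points lying in the supports of two
    different bumps: the increment of each of the two bumps is bounded
    separately. *)
Lemma signed_sum_lipschitz th (l : R) : 0 <= l ->
  (forall i x y, `|g i x - g i y| <= l * `|x - y|) ->
  forall x y, `|signed_sum th x - signed_sum th y| <= 2 * l * `|x - y|.
Proof.
move=> l0 gl.
have key x y i : g i y = 0 -> `|g i x| <= l * `|x - y|.
  by move=> giy; rewrite -[g i x]subr0 -giy.
have single x y i : g i x != 0 -> (forall j, g j y = 0) ->
    `|signed_sum th x - signed_sum th y| <= 2 * l * `|x - y|.
  move=> gix gy; rewrite (signed_sum_single th gix) (signed_sum_eq0 th gy).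
  rewrite subr0 normrM normrX normrN1 expr1n mul1r (le_trans (key x y i (gy i)))//.
  by rewrite -mulrA ler_peMl ?ler1n// mulr_ge0.
move=> x y.
have [[i gix]|gx] := bump_cases x; have [[j gjy]|gy] := bump_cases y.
- rewrite (signed_sum_single th gix) (signed_sum_single th gjy).
  have [ij|ij] := eqVneq i j.
    rewrite -ij -mulrBr normrM normrX normrN1 expr1n mul1r (le_trans (gl i x y))//.
    by rewrite -mulrA ler_peMl ?ler1n// mulr_ge0.
  have giy : g i y = 0.
    by apply/eqP; apply: contraTT isT => /g_disj /(_ gjy)/eqP; rewrite (negbTE ij).
  have gjx : g j x = 0.
    by apply/eqP; apply: contraTT isT => /(g_disj gix)/eqP; rewrite (negbTE ij).
  rewrite (le_trans (ler_normB _ _))// !normrM !normrX !normrN1 !expr1n !mul1r.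
  rewrite -mulrA mulrDl mul1r lerD//; first exact: key.
  by rewrite distrC; exact: key.
- exact: single gix gy.
- by rewrite distrC [X in _ * X]distrC; exact: single gjy gx.
- by rewrite !signed_sum_eq0// subrr normr0 !mulr_ge0.
Qed.

Lemma signed_sum_flip_out U th x : (forall i, i \in U -> g i x = 0) ->
  signed_sum (flip U th) x = signed_sum th x.
Proof.
move=> gU; apply: eq_bigr => i _; rewrite ffunE.
have [iU|] := boolP (i \in U); last by rewrite addbF.
by rewrite gU// !mulr0.
Qed.

Lemma signed_sum_flip_in U th x i : i \in U -> g i x != 0 ->
  `|signed_sum th x - signed_sum (flip U th) x| = 2 * `|g i x|.
Proof.
move=> iU gi; rewrite !(signed_sum_single _ gi) ffunE iU addbT signrN mulNr opprK.
by rewrite -mulr2n normrMn normrM normrX normrN1 expr1n mul1r mulr_natl.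
Qed.

(** The cells about whose sign the noiseless data are silent. *)
Definition unhit m (D : m.-tuple X) : {set I} :=
  [set i | [forall l, g i (tnth D l) == 0]].

(** A design point meets the support of at most one bump. *)
Lemma card_unhit m (D : m.-tuple X) : (#|I| <= #|unhit D| + m)%N.
Proof.
rewrite -(cardsC (unhit D)) leq_add2l.
have [->|[i0 _]] := set_0Vmem (~: unhit D); first by rewrite cards0.
case: m D => [|m] D in i0 *.
  rewrite (_ : ~: _ = finset.set0) ?cards0//; apply/finset.setP => i; rewrite !inE.
  by apply/negbF/forallP => -[].
(* [h] sends a visited cell to a design point visiting it. *)
pose h i := odflt ord0 [pick l | g i (tnth D l) != 0].
rewrite -[X in (_ <= X)%N]card_ord -(card_in_imset (f := h)) ?max_card//.
have hP i : i \in ~: unhit D -> g i (tnth D (h i)) != 0.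
  rewrite !inE => /forallPn[l gl]; rewrite /h; case: pickP => //= /(_ l).
  by rewrite gl.
by move=> i j /hP gi /hP gj hij; apply: (g_disj gi); rewrite hij.
Qed.

End signed_bumps.

(** * Lower bound on the risk of a class containing all signed sums *)

Section minimax_lower_bound.
Context {R : realType} {X Y : hilbertType R}.
Variables (sepY : separable Y) (mu : probability (borel X) R) (p : R).
Hypothesis p_ge1 : 1 <= p.
Variables (u : Y) (u1 : `|u| = 1).
Context {I : finType}.
Variables (g : I -> X -> R) (S : I -> set (borel X)) (r v : R).
Hypothesis g_disj : forall i j x, g i x != 0 -> g j x != 0 -> i = j.
Hypothesis g_cont : forall i, continuous (g i).
Hypothesis S_meas : forall i, measurable (S i).
Hypothesis r_gt0 : 0 < r.
Hypothesis g_low : forall i x, S i x -> r <= g i x.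
Hypothesis S_low : forall i, (v%:E <= mu (S i))%E.
Hypothesis v_ge0 : 0 <= v.

Definition signed_field (th : {ffun I -> bool}) (x : X) : Y :=
  signed_sum g th x *: u.

Lemma signed_field_measurable th :
  measurable_fun setT (signed_field th : borel X -> borel Y).
Proof.
apply: continuous_measurable_borel => x; apply: cvgZr_tmp.
apply: (@continuous_big R^o _ +%R 0 xpredT _ X _
  (fun i x => (-1) ^+ th i * g i x : R^o)) => [|i _ y].
  exact: add_continuous.
by apply: cvgMl_tmp; exact: g_cont.
Qed.

(** On each box [S i] with [i] in [U] the two fields differ by at least [2 * r],
    and these boxes are disjoint because they lie in disjoint supports. *)
Lemma signed_field_flip_dist (U : {set I}) th :
  ((2 * r * (#|U|%:R * v) `^ p^-1)%:E <=
     Lp_dist mu p (signed_field th) (signed_field (flip U th)))%E.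
Proof.
have p0 : 0 < p by exact: lt_le_trans p_ge1.
pose A := \bigcup_(i in [set` enum U]) S i.
have mA : measurable A by apply: fin_bigcup_measurable => // i _; exact: S_meas.
have muA : ((#|U|%:R * v)%:E <= mu A)%E.
  rewrite /A measure_fin_bigcup//; last first.
    move=> i j _ _ [x [Six Sjx]]; apply: (g_disj (x := x)).
      by rewrite gt_eqF// (lt_le_trans r_gt0)// g_low.
    by rewrite gt_eqF// (lt_le_trans r_gt0)// g_low.
  rewrite -fsbig_seq ?enum_uniq// big_enum /=.
  rewrite -[X in (X <= _)%E](_ : (\sum_(i in U) v%:E)%E = _).
    exact: lee_sum.
  by rewrite sumEFin sumr_const mulr_natl.
have mF := measurable_norm_sub sepY (signed_field_measurable th)
  (signed_field_measurable (flip U th)).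
have lowA x : A x -> 2 * r <= `|signed_field th x - signed_field (flip U th) x|.
  move=> [i /=]; rewrite mem_enum => iU Six.
  have gi : g i x != 0 by rewrite gt_eqF// (lt_le_trans r_gt0)// g_low.
  rewrite -scalerBl normrZ u1 mulr1 (signed_sum_flip_in g_disj th iU gi).
  by rewrite ler_pM2l// (le_trans _ (ler_norm _))// g_low.
have -> : (2 * r * (#|U|%:R * v) `^ p^-1)%:E = (((2 * r) `^ p * (#|U|%:R * v))%:E `^ p^-1)%E.
  rewrite poweR_EFin (@powRM _ ((2 * r) `^ p)) ?powR_ge0 ?mulr_ge0//.
  by rewrite -powRrM divff ?gt_eqF// powRr1// mulr_ge0// ltW.
rewrite /Lp_dist /Lp_norm Lnorm.unlock.
apply: gt0_ler_poweR; first by rewrite invr_ge0 ltW.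
- by rewrite in_itv /= leey andbT lee_fin !mulr_ge0 ?powR_ge0.
- by rewrite in_itv /= leey andbT integral_ge0// => x _; exact: poweR_ge0.
have mFp : measurable_fun setT (fun x : borel X =>
    ((`|signed_field th x - signed_field (flip U th) x|%:E) `^ p)%E).
  by apply: (measurableT_comp (measurable_poweR p)); exact/measurable_EFinP.
under eq_integral do rewrite abse_EFin normr_id.
apply: (@le_trans _ _ (\int[mu]_(x in A) ((2 * r) `^ p)%:E)%E).
  by rewrite integral_cst// EFinM lee_wpmul2l// lee_fin powR_ge0.
apply: (@le_trans _ _ (\int[mu]_(x in A)
    ((`|signed_field th x - signed_field (flip U th) x|%:E) `^ p))%E).
  apply: ge0_le_integral => //.
  - by move=> x _; rewrite lee_fin powR_ge0.
  - exact: measurable_funTS.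
  - move=> x Ax; rewrite poweR_EFin lee_fin ge0_ler_powR ?nnegrE ?mulr_ge0//.
    + exact: ltW.
    + exact: ltW.
    + exact: lowA.
by apply: ge0_subset_integral => // x _; exact: poweR_ge0.
Qed.

Section data.
Context d (T : measurableType d) d' (T' : measurableType d').
Variables (P : probability T R) (m : nat) (design : T -> m.-tuple X).
Variables (data : (X -> Y) -> T -> T') (Fhat : T' -> X -> Y).
Hypothesis m_small : (2 * m <= #|I|)%N.
Hypothesis data_local : forall F G z,
  (forall l, F (tnth (design z) l) = G (tnth (design z) l)) ->
  data F z = data G z.
Hypothesis data_meas : forall th, measurable_fun setT (data (signed_field th)).
Hypothesis Fhat_est : estimator mu p Fhat.

(** Flipping the signs of the cells that the design misses leaves the data
    unchanged, so the estimator returns the same [h] for both parameters, and by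
    the triangle inequality it pays at least the distance of the two fields.
    All this happens at a fixed outcome [z], which carries the noise and, for
    random designs, the design points. *)
Lemma signed_field_risk_ge :
  exists th, ((r * (#|I|%:R * v / 2) `^ p^-1)%:E <=
    \int[P]_z Lp_dist mu p (signed_field th) (Fhat (data (signed_field th) z)))%E.
Proof.
have p0 : 0 < p by exact: lt_le_trans p_ge1.
pose c : R := 2 * r * (#|I|%:R * v / 2) `^ p^-1.
pose loss th z := Lp_dist mu p (signed_field th) (Fhat (data (signed_field th) z)).
have mloss th : measurable_fun setT (loss th).
  exact: measurable_estimator_dist (signed_field_measurable th).
have -> : r * (#|I|%:R * v / 2) `^ p^-1 = c / 2 by rewrite /c; field.
change (exists th, ((c / 2)%:E <= \int[P]_z loss th z)%E).
apply: (@max_risk_ge_pairing _ _ _ P _ loss (fun z => flip (unhit g (design z)))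
  c [ffun=> false]) => //.
- by rewrite /c !mulr_ge0 ?powR_ge0// ltW.
- by move=> th z; exact: Lnorm_ge0.
- by move=> z; exact: flipK.
move=> th z; set U := unhit _ _.
rewrite /loss.
have -> : data (signed_field (flip U th)) z = data (signed_field th) z.
  apply: data_local => l; rewrite /signed_field signed_sum_flip_out// => i.
  by rewrite inE => /forallP/(_ l)/eqP.
set h := Fhat _.
have mh : measurable_fun setT (h : borel X -> borel Y) by exact: (Fhat_est.1 _).1.
rewrite [X in (_ + X)%E]Lp_distC.
apply: le_trans (Lp_dist_triangle sepY mu p_ge1 (signed_field_measurable th) mh
  (signed_field_measurable (flip U th))).
apply: le_trans (signed_field_flip_dist U th).
rewrite lee_fin ler_pM2l ?mulr_gt0//.
have hU : #|I|%:R / 2 <= #|U|%:R :> R.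
  have : (#|I| <= 2 * #|U|)%N by have := card_unhit g_disj (design z); rewrite -/U; lia.
  by rewrite ler_pdivrMr// mulrC -natrM ler_nat.
apply: ge0_ler_powR; rewrite ?nnegrE ?invr_ge0 ?mulr_ge0//.
- by rewrite ltW.
- by rewrite mulrAC ler_wpM2r.
Qed.

End data.

Context {d : measure_display} {O : measurableType d}.
Variables (gamma : probability O R) (obs : Y -> O -> O) (cF : set (X -> Y)).
Variable m : nat.
Hypothesis m_small : (2 * m <= #|I|)%N.
Hypothesis cF_signed : forall th, cF (signed_field th).
Hypothesis obs_meas : forall F : borel X -> borel Y, measurable_fun setT F ->
  measurable_fun setT (fun xo : borel X * O => obs (F xo.1) xo.2).

Lemma fixed_design_risk_ge :
  ((r * (#|I|%:R * v / 2) `^ p^-1)%:E <= fixed_design_risk mu p gamma obs cF m)%E.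
Proof.
apply: le_ereal_inf_tmp => _ [D _ <-]; apply: le_ereal_inf_tmp => _ [Fhat eF <-].
have [||th hth] := signed_field_risk_ge (iid_law gamma m) (design := fun=> D)
  (data := fixed_data obs D) m_small _ _ eF.
- move=> F G e FG; apply: eq_from_tnth => l; rewrite !tnth_mktuple; congr obs.
  exact: FG.
- move=> th; apply/measurable_fun_tnthP => i.
  rewrite (_ : _ \o _ = (fun o => obs (signed_field th (tnth D i)) o) \o
    (fun e : m.-tuple O => tnth e i)); last first.
    by apply/funext => e /=; rewrite tnth_mktuple.
  apply: measurableT_comp; last exact: measurable_tnth.
  exact: (measurableT_comp
    (obs_meas (measurable_cst (signed_field th (tnth D i) : borel Y)))
    (measurable_fun_pair (measurable_cst (point : borel X)) (@measurable_id _ O setT))).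
apply: le_trans hth _; apply: ereal_sup_ubound; exists (signed_field th) => //.
Qed.

Lemma random_design_risk_ge :
  ((r * (#|I|%:R * v / 2) `^ p^-1)%:E <= random_design_risk mu p gamma obs cF m)%E.
Proof.
apply: le_ereal_inf_tmp => _ [nu _ <-]; apply: le_ereal_inf_tmp => _ [Fhat eF <-].
have [||th hth] := signed_field_risk_ge (iid_law (nu \x gamma)%E m)
  (design := fun z => [tuple (tnth z l).1 | l < m])
  (data := random_data obs (m := m)) m_small _ _ eF.
- move=> F G z FG; apply: eq_from_tnth => l; rewrite !tnth_mktuple.
  by have := FG l; rewrite tnth_mktuple => ->.
- move=> th; apply/measurable_fun_tnthP => i.
  rewrite (_ : _ \o _ = (fun xo => (xo.1, obs (signed_field th xo.1) xo.2)) \o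
    (fun z : m.-tuple (borel X * O) => tnth z i)); last first.
    by apply/funext => e /=; rewrite tnth_mktuple.
  apply: measurableT_comp; last exact: measurable_tnth.
  apply: measurable_fun_pair; first exact: measurable_fst.
  exact: obs_meas (signed_field_measurable th).
apply: le_trans hth _; apply: ereal_sup_ubound; exists (signed_field th) => //.
Qed.

End minimax_lower_bound.

(** * Bumps on a grid in the first coordinates of the design space *)

Lemma lipschitz_continuous_real {R : realType} {X : normedModType R} (f : X -> R) (l : R) :
  (forall x y, `|f x - f y| <= l * `|x - y|) -> continuous f.
Proof.
move=> fl x; apply/cvgrPdist_lt => e e0.
have l0 : 0 < `|l| + 1 by rewrite ltr_wpDl.
near=> y; rewrite (le_lt_trans (fl x y))//.
apply: (@le_lt_trans _ _ ((`|l| + 1) * `|x - y|)).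
  by rewrite ler_wpM2r// (le_trans (ler_norm l))// lerDl.
rewrite mulrC -ltr_pdivlMr//; near: y.
have e1 : 0 < e / (`|l| + 1) by rewrite divr_gt0.
by apply: (@cvgr_dist_lt _ _ _ (nbhs x) _ id x) => //; exact: cvg_id.
Unshelve. all: by end_near. Qed.

Lemma lee_prod_const {R : realType} (c : R) (s : seq nat) (f : nat -> \bar R) :
  0 <= c -> (forall i, i \in s -> (c%:E <= f i)%E) ->
  ((c ^+ size s)%:E <= \prod_(i <- s) f i)%E.
Proof.
move=> c0; elim: s => [|i s IHs] cf; first by rewrite big_nil.
rewrite big_cons /= exprS EFinM; apply: lee_pmul; rewrite ?lee_fin ?exprn_ge0//.
  by apply: cf; rewrite mem_head.
by apply: IHs => j js; apply: cf; rewrite in_cons js orbT.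
Qed.

Section bump_construction.
Context {R : realType} {X : hilbertType R}.
Variables (mu : probability (borel X) R) (lambda : nat -> R) (phi : nat -> X).
Hypothesis phi_unit : forall i, '[phi i, phi i] = 1.
Hypothesis indep : mutually_independent mu (xi lambda phi).
Variables (a b : R).
Hypotheses (a_gt0 : 0 < a) (b_gt0 : 0 < b).
Hypothesis low : forall i, exists2 nu : R -> R, has_density mu (xi lambda phi i) nu &
      forall x, `|x| <= a -> b <= nu x.
Local Notation xi := (xi lambda phi).

Lemma xi_lipschitz i x y :
  `|xi i x - xi i y| <= (Num.sqrt (lambda i))^-1 * `|(x : X) - y|.
Proof.
rewrite /Defs.xi -mulrBl -inner_subl normrM mulrC.
rewrite ger0_norm ?invr_ge0 ?sqrtr_ge0// ler_wpM2l ?invr_ge0 ?sqrtr_ge0//.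
exact: abs_inner_unit.
Qed.

Lemma xi_measurable i : measurable_fun setT (xi i).
Proof.
apply: continuous_measurable_real; apply: lipschitz_continuous_real.
exact: xi_lipschitz.
Qed.

Lemma xi_interval_prob i (s t : R) : - a <= s -> s <= t -> t <= a ->
  ((b * (t - s))%:E <= mu (xi i @^-1` `[s, t]))%E.
Proof.
move=> as_ st ta; have [nu [mnu nu0 dens] hnu] := low i.
rewrite dens//; apply: (@le_trans _ _ (\int[lebesgue_measure]_(x in `[s, t]) (cst b%:E x))%E).
  rewrite integral_cst// [X in (_ * X)%E](lebesgue_measure_itv `[s, t]) /= lte_fin.
  have [lt|] := ltP s t; first by rewrite -EFinD -EFinM.
  by move=> ts; rewrite (_ : t = s) ?subrr ?mulr0 ?mule0//; apply/eqP; rewrite eq_le ts.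
apply: ge0_le_integral => //.
- by move=> x _; rewrite lee_fin ltW.
- by apply/measurable_EFinP; exact: measurable_funTS.
- move=> x; rewrite /= in_itv /= => /andP[sx xt]; rewrite lee_fin; apply: hnu.
  by rewrite ler_norml (le_trans as_ sx) (le_trans xt ta).
Qed.

(** In the coordinates [xi 0, ..., xi k] the cube [[0, a]^(k+1)] carries a grid
    of [n ^ (k+1)] centers with spacing [a / n].  [tent c] is a cone around
    the center of [c], for the l^1 distance in these coordinates, which vanishes
    beyond the radius [a / (2 * n)]. *)
Section grid.
Variables (k n : nat).
Hypothesis n_gt0 : (0 < n)%N.
Variable tau : R.
Hypothesis tau_gt0 : 0 < tau.
Local Notation cell := {ffun 'I_k.+1 -> 'I_n}.
Implicit Types c : cell.

(** The index is a natural number rather than an ordinal because independence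
    is stated for families of events indexed by [nat]. *)
Definition center c (i : nat) : R := a * (c (inord i) : nat)%:R / n%:R.

Definition coord_dist c (x : X) : R := \sum_(i < k.+1) `|xi i x - center c i|.

Definition tent c (x : X) : R := tau * Num.max 0 (a / (2 * n%:R) - coord_dist c x).

Definition halfwidth : R := a / (4 * n%:R * k.+1%:R).

(** The half-width is chosen such that the l^1 distance to the center is at most
    half the radius of the tent on the whole box. *)
Definition box c : set (borel X) := \bigcap_(i in [set` iota 0 k.+1])
  (xi i @^-1` `[center c i - halfwidth, center c i + halfwidth]).

Let nR : 0 < n%:R :> R. Proof. by rewrite ltr0n. Qed.
Let kR : 0 < k.+1%:R :> R. Proof. by rewrite ltr0n. Qed.

Lemma center_sep c c' i : c (inord i) != c' (inord i) ->
  a / n%:R <= `|center c i - center c' i|.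
Proof.
move=> cc'; rewrite /center -!mulrA -mulrBr -mulrBl normrM (gtr0_norm a_gt0).
rewrite normrM [X in _ <= _ * (_ * X)]gtr0_norm ?invr_gt0//.
rewrite ler_wpM2l ?(ltW a_gt0)// ler_peMl ?invr_ge0 ?(ltW nR)//.
have {cc'} : (c (inord i) : nat) != c' (inord i) by [].
move: (nat_of_ord _) (nat_of_ord _) => s t; rewrite neq_ltn => /orP[] st.
  by rewrite distrC -natrB ?(ltnW st)// normr_nat ler1n subn_gt0.
by rewrite -natrB ?(ltnW st)// normr_nat ler1n subn_gt0.
Qed.

Lemma tent_neq0 c x : tent c x != 0 -> coord_dist c x < a / (2 * n%:R).
Proof.
by apply: contraR; rewrite -leNgt => h; rewrite /tent max_l ?mulr0// subr_le0.
Qed.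

(** Distinct centers are at l^1 distance at least [a / n], twice the radius. *)
Lemma tent_disjoint c c' x : tent c x != 0 -> tent c' x != 0 -> c = c'.
Proof.
move=> /tent_neq0 h /tent_neq0 h'; apply/ffunP => i; apply/eqP.
apply: contraTT isT => cc'.
have := @center_sep c c' i; rewrite inord_val => /(_ cc').
have hi d : `|xi i x - center d i| <= coord_dist d x.
  by rewrite /coord_dist (bigD1 i)//= lerDl sumr_ge0.
have := hi c; have := hi c' => h1 h2 h3.
have := ler_distD (xi i x) (center c i) (center c' i).
rewrite [X in _ <= X + _]distrC.
have e : a / n%:R = a / (2 * n%:R) + a / (2 * n%:R) by field; rewrite gt_eqF.
lra.
Qed.

Lemma coord_dist_ge0 c x : 0 <= coord_dist c x.
Proof. exact: sumr_ge0. Qed.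

Lemma tent_bounded c x : `|tent c x| <= tau * a.
Proof.
rewrite normrM gtr0_norm// ler_pM2l// ger0_norm ?le_max ?lexx//.
rewrite ge_max (ltW a_gt0)/= (le_trans _ (_ : a / (2 * n%:R) <= a))//.
  by rewrite lerBlDr lerDl coord_dist_ge0.
rewrite ler_piMr ?(ltW a_gt0)// invf_le1 ?mulr_gt0//.
by rewrite -natrM ler1n muln_gt0.
Qed.

Lemma tent_lipschitz c x y :
  `|tent c x - tent c y| <=
    tau * (\sum_(i < k.+1) (Num.sqrt (lambda i))^-1) * `|x - y|.
Proof.
rewrite /tent -mulrBr normrM gtr0_norm// -mulrA ler_pM2l//.
apply: (@le_trans _ _ `|coord_dist c x - coord_dist c y|).
  have max_lip (s t : R) : `|Num.max 0 s - Num.max 0 t| <= `|s - t|.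
    have := ler_norm (s - t); have := ler_norm (t - s); rewrite distrC.
    by case: (leP 0 s) => ?; case: (leP 0 t) => ? ? ?; rewrite ler_norml; lra.
  by rewrite (le_trans (max_lip _ _))// opprB addrC addrA addrNK distrC.
rewrite /coord_dist -sumrB (le_trans (ler_norm_sum _ _ _))// mulr_suml.
apply: ler_sum => i _; apply: le_trans (xi_lipschitz i x y).
apply: (le_trans (ler_dist_dist _ _)).
by rewrite opprB addrA subrK.
Qed.

Lemma box_measurable c : measurable (box c).
Proof.
apply: fin_bigcap_measurable => // i _; rewrite -[X in measurable X]setTI.
exact: xi_measurable.
Qed.

Lemma tent_on_box c x : box c x -> tau * (a / (4 * n%:R)) <= tent c x.
Proof.
move=> Sx; rewrite ler_pM2l// le_max; apply/orP; right.
rewrite lerBrDl -lerBrDr.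
have -> : a / (2 * n%:R) - a / (4 * n%:R) = \sum_(i < k.+1) halfwidth.
  rewrite sumr_const card_ord -mulr_natl /halfwidth.
  by field; rewrite !gt_eqF.
apply: ler_sum => i _; have := Sx i; rewrite /mkset mem_iota add0n ltn_ord => /(_ isT).
by rewrite /= in_itv /= ler_distl.
Qed.

(** By independence the probability is the product over the coordinates, each
    factor being bounded below by the density.  The intervals stay in [[-a, a]]
    because the half-width is at most the spacing and the last center is at most
    [a - a / n]. *)
Lemma box_prob c : (((a * b / (2 * n%:R * k.+1%:R)) ^+ k.+1)%:E <= mu (box c))%E.
Proof.
rewrite /box indep ?iota_uniq//.
apply: le_trans (lee_prod_const (s := iota 0 k.+1) _ _); first by rewrite size_iota.
  by rewrite divr_ge0 ?mulr_ge0// ltW.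
move=> i; rewrite mem_iota add0n => ik.
have hw0 : 0 < halfwidth by rewrite divr_gt0// !mulr_gt0.
have hw : halfwidth <= a / n%:R.
  rewrite ler_pM2l// lef_pV2 ?posrE ?mulr_gt0// mulrAC ler_peMl ?(ltW nR)//.
  by rewrite -natrM ler1n.
have hwa : halfwidth <= a.
  by rewrite (le_trans hw)// ler_piMr ?(ltW a_gt0)// invf_le1// ler1n.
have c0 : 0 <= center c i by rewrite !mulr_ge0 ?invr_ge0// ltW.
have c1 : center c i <= a - a / n%:R.
  rewrite /center -mulrA -[X in _ <= X - _]mulr1 -mulrBr ler_pM2l//.
  rewrite ler_pdivrMr// mulrBl mul1r mulVf ?gt_eqF//.
  by rewrite lerBrDr natr1 ler_nat.
apply: le_trans (xi_interval_prob _ _ _ _).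
- rewrite lee_fin (_ : _ - (_ - _) = 2 * halfwidth); last by ring.
  by rewrite le_eqVlt; apply/orP; left; apply/eqP; rewrite /halfwidth; field; rewrite !gt_eqF.
- lra.
- lra.
- lra.
Qed.

End grid.

End bump_construction.

(** * Superpolynomial minimax risk *)

(** Along [m = n ^ K] the sequence is at least [C * n `^ (K * q - 1)]. *)
Lemma limn_esup_pinfty {R : realType} (risk : nat -> \bar R) (K : nat) (C q : R) :
  0 < C -> (0 < K)%N -> 1 < K%:R * q ->
  (forall n, (0 < n)%N -> ((C / n%:R)%:E <= risk (n ^ K)%N)%E) ->
  limn_esup (fun m => risk m * (m%:R `^ q)%:E)%E = +oo%E.
Proof.
move=> C0 K0 Kq hrisk; rewrite limn_esup_lim.
rewrite [X in limn X](_ : _ = cst +oo%E) ?lim_cst//; apply/funext => N /=.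
apply/eqyP => A A0.
pose e := K%:R * q - 1; have e0 : 0 < e by rewrite subr_gt0.
have AC : 0 <= A / C by rewrite divr_ge0// ltW.
pose j := maxn N.+1 (Num.bound ((A / C) `^ e^-1)).
have j0 : (0 < j)%N by rewrite leq_max.
have jR : 0 < j%:R :> R by rewrite ltr0n.
have jA : A / C <= j%:R `^ e.
  rewrite [leLHS](_ : _ = ((A / C) `^ e^-1) `^ e); last first.
    by rewrite -powRrM mulVf ?gt_eqF// powRr1.
  apply: ge0_ler_powR; rewrite ?nnegrE ?powR_ge0 ?ler0n//; first exact: ltW.
  apply: ltW; apply: lt_le_trans (archi_boundP (powR_ge0 _ _)) _.
  by rewrite ler_nat leq_max leqnn orbT.
apply: (@le_trans _ _ (risk (j ^ K)%N * ((j ^ K)%N%:R `^ q)%:E)%E); last first.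
  apply: ereal_sup_ubound; exists (j ^ K)%N => //=.
  rewrite (@leq_trans j)// ?leq_max ?leqnSn//.
  by rewrite -[X in (X <= _)%N]expn1 leq_pexp2l.
apply: (@le_trans _ _ ((C / j%:R)%:E * ((j ^ K)%N%:R `^ q)%:E)%E); last first.
  by apply: lee_wpmul2r; [rewrite lee_fin powR_ge0|exact: hrisk].
rewrite -EFinM lee_fin natrX -powR_mulrn ?ler0n// -powRrM.
rewrite -[K%:R * q](subrK 1) -/e powRD; last by rewrite (gt_eqF jR) implybT.
rewrite powRr1 ?ler0n// [leRHS](_ : _ = j%:R `^ e * C).
  by rewrite -ler_pdivrMr.
by field; rewrite gt_eqF.
Qed.

Section rate.
Context {R : realType} {X Y : hilbertType R}.
Variables (sepY : separable Y) (mu : probability (borel X) R) (p : R).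
Hypothesis p_ge1 : 1 <= p.
Variables (lambda : nat -> R) (phi : nat -> X).
Hypothesis mu_basis : covariance_eigenbasis mu lambda phi.
Hypothesis mu_indep : mutually_independent mu (xi lambda phi).
Hypothesis mu_lower : densities_bounded_below mu (xi lambda phi).
Context {d : measure_display} {O : measurableType d}.
Variables (gamma : probability O R) (obs : Y -> O -> O) (cF : set (X -> Y)).
Hypothesis obs_meas : forall F : borel X -> borel Y, measurable_fun setT F ->
  measurable_fun setT (fun xo : borel X * O => obs (F xo.1) xo.2).
Variables (u : Y) (b0 l0 : R).
Hypotheses (u_unit : `|u| = 1) (b0_gt0 : 0 < b0) (l0_gt0 : 0 < l0).
Hypothesis cF_line : forall f : X -> R, (forall x, `|f x| <= b0) ->
  (forall x y, `|f x - f y| <= l0 * `|x - y|) -> cF (fun x => f x *: u).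

(** With [n ^ (k+1)] observations and [(2 * n) ^ (k+1)] cells, at least half of
    the cells are missed.  The height of a bump is of order [1 / n], while the
    missed boxes have total probability bounded below independently of [n],
    whence a risk of order [1 / n], that is [m ^ (- 1 / (k+1))]. *)
Lemma minimax_risk_rate (k : nat) : exists2 C : R, 0 < C & forall n, (0 < n)%N ->
  ((C / n%:R)%:E <= fixed_design_risk mu p gamma obs cF (n ^ k.+1))%E /\
  ((C / n%:R)%:E <= random_design_risk mu p gamma obs cF (n ^ k.+1))%E.
Proof.
have [[phi_on _] _ _ _] := mu_basis.
have phi1 i : '[phi i, phi i] = 1 by rewrite phi_on// eqxx.
have [a [b [a0 b_gt0 low]]] := mu_lower.
pose K : R := \sum_(i < k.+1) (Num.sqrt (lambda i))^-1.
have K0 : 0 <= K by apply: sumr_ge0 => i _; rewrite invr_ge0 sqrtr_ge0.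
pose tau := Num.min (b0 / a) (l0 / (2 * (K + 1))).
have tau0 : 0 < tau by rewrite lt_min !divr_gt0// mulr_gt0// ltr_wpDl.
have tau_b : tau * a <= b0 by rewrite -ler_pdivlMr// /tau ge_min lexx.
have tau_l : 2 * (tau * K) <= l0.
  have : tau * (2 * (K + 1)) <= l0.
    by rewrite -ler_pdivlMr ?mulr_gt0 ?ltr_wpDl// /tau ge_min lexx orbT.
  by move=> h; have := mulr_gt0 tau0 (ltr01); lra.
(* Half of the total probability of all the boxes, which does not depend on [n]. *)
pose kap : R := (a * b / (2 * k.+1%:R)) ^+ k.+1 / 2.
have kap0 : 0 < kap by rewrite divr_gt0// exprn_gt0// divr_gt0// mulr_gt0.
exists (tau * a / 8 * kap `^ p^-1) => [|n n0].
  by rewrite mulr_gt0 ?powR_gt0// divr_gt0// mulr_gt0.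
have n2 : (0 < 2 * n)%N by rewrite muln_gt0.
have nR : 0 < n%:R :> R by rewrite ltr0n.
have kR : 0 < k.+1%:R :> R by rewrite ltr0n.
pose cell := {ffun 'I_k.+1 -> 'I_(2 * n)}.
have cardI : #|{: cell}| = ((2 * n) ^ k.+1)%N by rewrite card_ffun !card_ord.
pose g : cell -> X -> R := tent lambda phi a tau.
pose S : cell -> set (borel X) := fun c => box lambda phi a c.
pose r := tau * (a / (4 * (2 * n)%N%:R)).
pose v := (a * b / (2 * (2 * n)%N%:R * k.+1%:R)) ^+ k.+1.
have gl : forall c x y, `|g c x - g c y| <= tau * K * `|x - y|.
  exact: tent_lipschitz.
have gd : forall c c' x, g c x != 0 -> g c' x != 0 -> c = c' by exact: tent_disjoint.
have gc c : continuous (g c) by apply: lipschitz_continuous_real (gl c).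
have Sm c : measurable (S c) by exact: box_measurable.
have r0 : 0 < r by rewrite mulr_gt0// divr_gt0// mulr_gt0// ltr0n.
have v0 : 0 <= v.
  by rewrite exprn_ge0// divr_ge0 ?mulr_ge0// ltW.
have glow : forall c x, S c x -> r <= g c x by exact: tent_on_box.
have Slow : forall c, (v%:E <= mu (S c))%E by exact: box_prob.
have msmall : (2 * n ^ k.+1 <= #|{: cell}|)%N.
  by rewrite cardI expnMn leq_mul// expnS leq_pmulr// expn_gt0.
have cFs th : cF (signed_field u g th).
  apply: cF_line.
    apply: signed_sum_bounded => //; first exact: ltW.
    by move=> c x; apply: le_trans tau_b; exact: tent_bounded.
  move=> x y; have := signed_sum_lipschitz gd th (mulr_ge0 (ltW tau0) K0) gl x y.
  by move=> /le_trans; apply; rewrite ler_wpM2r.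
have -> : tau * a / 8 * kap `^ p^-1 / n%:R = r * (#|{: cell}|%:R * v / 2) `^ p^-1.
  have -> : #|{: cell}|%:R * v / 2 = kap.
    rewrite cardI natrX /v -exprMn /kap; congr (_ ^+ _ / _).
    by rewrite natrM; field; rewrite !gt_eqF.
  by rewrite /r natrM; field; rewrite !gt_eqF.
split; [exact: (fixed_design_risk_ge sepY p_ge1 u_unit gd gc Sm r0 glow Slow v0)
       |exact: (random_design_risk_ge sepY p_ge1 u_unit gd gc Sm r0 glow Slow v0)].
Qed.

Lemma minimax_risk_superpolynomial (q : R) : 0 < q ->
  limn_esup (fun m => fixed_design_risk mu p gamma obs cF m * (m%:R `^ q)%:E)%E = +oo%E /\
  limn_esup (fun m => random_design_risk mu p gamma obs cF m * (m%:R `^ q)%:E)%E = +oo%E.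
Proof.
move=> q0; pose k := Num.bound q^-1.
have kq : 1 < k.+1%:R * q.
  rewrite -ltr_pdivrMr// div1r.
  have qV0 : 0 <= q^-1 by rewrite invr_ge0 ltW.
  by apply: lt_le_trans (archi_boundP qV0) _; rewrite ler_nat.
have [C C0 hC] := minimax_risk_rate k.
by split; apply: (limn_esup_pinfty C0 (ltn0Sn k) kq) => n /hC[].
Qed.

End rate.

(** * The two observation models *)

Section observations.
Context {R : realType} {X Y : hilbertType R}.
Implicit Types F : borel X -> borel Y.

Lemma hilbert_obs_measurable (sepY : separable Y) (sigma : R) F :
  measurable_fun setT F ->
  measurable_fun setT (fun xo : borel X * borel Y => hilbert_obs sigma (F xo.1) xo.2).
Proof.
move=> mF.
have cop : continuous (fun z : Y * Y => z.1 + sigma *: z.2).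
  by move=> z; apply: cvgD; [exact: cvg_fst|apply: cvgZl_tmp; exact: cvg_snd].
exact: (measurable_comp2_separable sepY cop (measurableT_comp mF measurable_fst)
  measurable_snd).
Qed.

Lemma inner_continuous (y : Y) : continuous (fun x => '[x, y]).
Proof.
apply: (@lipschitz_continuous_real _ _ _ `|y|) => x x'; rewrite -inner_subl.
have [->|y0] := eqVneq y 0.
  by rewrite inner_sym -[0](scale0r (x - x')) inner_scalel mul0r !normr0 mulr_ge0.
have ny : 0 < `|y| by rewrite normr_gt0.
have e1 : '[`|y|^-1 *: y, `|y|^-1 *: y] = 1.
  by rewrite inner_norm normrZ gtr0_norm ?invr_gt0// mulVf ?gt_eqF// expr1n.
have := abs_inner_unit (x - x') e1.
rewrite inner_sym inner_scalel normrM gtr0_norm ?invr_gt0// inner_sym.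
by rewrite ler_pdivrMl.
Qed.

Lemma white_obs_measurable (sigma : R) F :
  measurable_fun setT F ->
  measurable_fun setT (fun xo : borel X * process Y => white_obs sigma (F xo.1) xo.2).
Proof.
move=> mF.
apply: (@measurability _ _ _ (process Y) setT _ (@cylinders _ Y)); first by [].
move=> _ [_ [y [A [mA ->]]] <-]; rewrite setTI.
pose h (xo : borel X * process Y) : R := '[F xo.1 : Y, y] + sigma * xo.2 y.
change (measurable (h @^-1` A)).
have mcoord : measurable_fun setT (fun o : process Y => o y).
  by move=> _ B mB; rewrite setTI; apply: sub_sigma_algebra; exists y, B.
have mh : measurable_fun setT h.
  apply: measurable_funD.
    exact: (measurableT_comp (continuous_measurable_real (@inner_continuous y))
      (measurableT_comp mF measurable_fst)).
  apply: measurable_funM => //.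
  exact: (measurableT_comp mcoord measurable_snd).
by rewrite -[X in measurable X]setTI; exact: mh.
Qed.

End observations.

(** * The two target classes contain Lipschitz functions along a line *)

Section target_classes.
Context {R : realType} {X Y : hilbertType R}.

Lemma lipschitz_class_line (B L : R) (u : Y) (f : X -> R) : `|u| = 1 ->
  (forall x, `|f x| <= B) -> (forall x y, `|f x - f y| <= L * `|x - y|) ->
  lipschitz_class B L (fun x => f x *: u).
Proof.
by move=> u1 fB fL; split=> [x|x y]; rewrite -?scalerBl normrZ u1 mulr1.
Qed.

Lemma weighted_norm_basis (J : set nat) (psi : nat -> Y) (w : nat -> R) (t s : R) i :
  orthonormal_basis J psi -> J i -> 0 < w i ->
  weighted_norm J psi w t (s *: psi i) = (`|s| * w i `^ t)%:E.
Proof.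
move=> [on _] Ji wi; rewrite /weighted_norm.
have -> : (\esum_(j in J) (w j `^ (2 * t) * `|'[s *: psi i, psi j]| ^+ 2)%:E =
    ((`|s| * w i `^ t) `^ 2)%:E)%E.
  transitivity (\esum_(j in [set i]) ((`|s| * w i `^ t) `^ 2)%:E)%E; last first.
    by rewrite esum_set1// lee_fin powR_ge0.
  rewrite [LHS]esum_mkcond [RHS]esum_mkcond; apply: eq_esum => j _.
  have [->|ji] := eqVneq j i.
    rewrite !mem_set// inner_scalel on// eqxx mulr1 powRM ?powR_ge0// -powRrM.
    by rewrite mulrC [t * 2]mulrC -powR_mulrn ?normr_ge0// normr_id.
  rewrite [X in _ = if X then _ else _]memNset; last by move=> /= /eqP; apply/negP.
  case: ifPn => // /set_mem Jj; rewrite inner_scalel on// eq_sym (negbTE ji).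
  by rewrite mulr0 normr0 expr0n mulr0.
by rewrite poweR_EFin -powRrM divff ?pnatr_eq0// powRr1// mulr_ge0// powR_ge0.
Qed.

Lemma weighted_lipschitz_class_line (J : set nat) (psi : nat -> Y) (w : nat -> R)
    (t B L : R) i (f : X -> R) :
  orthonormal_basis J psi -> J i -> 0 < w i ->
  (forall x, `|f x| <= B / w i `^ t) -> (forall x y, `|f x - f y| <= L * `|x - y|) ->
  weighted_lipschitz_class J psi w t B L (fun x => f x *: psi i).
Proof.
move=> on Ji wi fB fL; split=> [x|x y].
  by rewrite weighted_norm_basis// lee_fin -ler_pdivlMr ?powR_gt0.
by rewrite -scalerBl normrZ unit_norm ?mulr1// on.1// eqxx.
Qed.

Lemma empty_orthonormal_basis (J : set nat) (psi : nat -> Y) : J = set0 ->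
  orthonormal_basis J psi <-> forall y : Y, y = 0.
Proof.
move=> ->; have sum0 (y : Y) : (fun n : nat =>
    \sum_(i < n | (i : nat) \in (set0 : set nat)) '[y, psi i] *: psi i) = cst 0.
  by apply/funext => n; rewrite big1// => i; rewrite in_set0.
split=> [[_ cv] y|Y0]; last first.
  by split => // y; rewrite sum0 (Y0 y); exact: cvg_cst.
have := cv y; rewrite sum0 => h.
by apply: (@norm_cvg_unique _ _ _ _ _ _ h); exact: cvg_cst.
Qed.

(** In the zero space the empty family is an orthonormal basis, for which the
    trace is 0. *)
Lemma has_trace1_unit_vector (Ups : Y -> Y) : has_trace Ups 1 -> exists u : Y, `|u| = 1.
Proof.
move=> tr; have [[y y0]|/forallNP Y0] := pselect (exists y : Y, y != 0).
  exists (`|y|^-1 *: y).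
  by rewrite normrZ gtr0_norm ?invr_gt0 ?normr_gt0// mulVf ?normr_eq0.
have := tr set0 (fun=> 0); rewrite esum_set0 => h.
suff /h : orthonormal_basis set0 (fun=> 0 : Y) by move=> [] /eqP; rewrite eq_sym oner_eq0.
by apply/empty_orthonormal_basis => // y; have /negP := Y0 y; rewrite negbK => /eqP.
Qed.

End target_classes.

Theorem proposition2p4 (R : realType) (X Y : hilbertType R)
    (sepX : separable X) (sepY : separable Y)
    (B L sigma p : R) (B_gt0 : 0 < B) (L_gt0 : 0 < L)
    (sigma_gt0 : 0 < sigma) (p_ge1 : 1 <= p)
    (mu : probability (borel X) R)
    (mu_mean : mean_zero mu) (mu_moment : finite_second_moment mu)
    (lambda : nat -> R) (phi : nat -> X)
    (mu_basis : covariance_eigenbasis mu lambda phi)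
    (mu_indep : mutually_independent mu (xi lambda phi))
    (mu_lower : densities_bounded_below mu (xi lambda phi))
    (mu_upper : bounded_moments mu (Num.max p 2) (xi lambda phi)) :
  (forall (gamma : probability (borel Y) R) (Ups : {linear Y -> Y}),
     hilbert_gaussian gamma Ups ->
     forall q : R, 0 < q ->
       limn_esup (fun m => fixed_design_risk mu p gamma (hilbert_obs sigma)
         (lipschitz_class B L) m * (m%:R `^ q)%:E)%E = +oo%E /\
       limn_esup (fun m => random_design_risk mu p gamma (hilbert_obs sigma)
         (lipschitz_class B L) m * (m%:R `^ q)%:E)%E = +oo%E) /\
  (forall (gamma : probability (process Y) R) (J : set nat)
     (psi : nat -> Y) (w : nat -> R) (t : R),
     white_noise gamma ->
     (exists y : Y, y != 0) ->
     orthonormal_basis J psi ->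
     (forall i, 0 < w i) -> (forall i j, (i <= j)%N -> w i <= w j) ->
     0 < t ->
     forall q : R, 0 < q ->
       limn_esup (fun m => fixed_design_risk mu p gamma (white_obs sigma)
         (weighted_lipschitz_class J psi w t B L) m * (m%:R `^ q)%:E)%E
         = +oo%E /\
       limn_esup (fun m => random_design_risk mu p gamma (white_obs sigma)
         (weighted_lipschitz_class J psi w t B L) m * (m%:R `^ q)%:E)%E
         = +oo%E).
Proof.
split=> [gamma Ups [_ _ tr] q q0|gamma J psi w t _ [y0 y0_neq0] psi_on w_gt0 _ _ q q0].
  have [u u1] := has_trace1_unit_vector tr.
  apply: (minimax_risk_superpolynomial sepY p_ge1 mu_basis mu_indep mu_lower
    gamma _ u1 B_gt0 L_gt0) => //.
  - by move=> F; exact: hilbert_obs_measurable.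
  - by move=> f; exact: lipschitz_class_line.
have [i Ji] : exists i, J i.
  apply: contrapT => /forallNP J0.
  have JE : J = set0 by apply/seteqP; split => // i /J0.
  by move/eqP: y0_neq0; apply; exact: (empty_orthonormal_basis psi JE).1.
have u1 : `|psi i| = 1 by rewrite unit_norm// psi_on.1// eqxx.
apply: (minimax_risk_superpolynomial sepY p_ge1 mu_basis mu_indep mu_lower
    gamma _ u1 (divr_gt0 B_gt0 (powR_gt0 t (w_gt0 i))) L_gt0) => //.
- by move=> F; exact: white_obs_measurable.
- by move=> f; exact: weighted_lipschitz_class_line.
Qed.
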